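(* Let $A$ and $U$ be Hopf algebras over $\mathbf C$ with a nondegenerate Hopf pairing, and let $T\subset\ker\varepsilon'\subset U$ be a finite-dimensional linear subspace with basis $\{\chi_i\}$ such that $\mathrm{ad}_\psi T\subset T$ for all $\psi\in U$; let $M_i{}^j\in A$ be the elements determined by $\mathrm{ad}_\psi\chi_i=\langle\psi,M_i{}^j\rangle\chi_j$ for all $\psi\in U$. Let $\Gamma$ be the left $A$-module freely generated by symbols $\omega^i$ (the basis dual to $\{\chi_i\}$), with $d:A\to\Gamma$, $da=(\chi_i*a)\,\omega^i$, and with $$\Delta_L(a_i\omega^i)=\Delta(a_i)(I\otimes\omega^i),\qquad \Delta_R(a_i\omega^i)=\Delta(a_i)(\omega^j\otimes M_j{}^i).$$ Then the exterior differential $d$ is bicovariant on $\Gamma$: for all $a,b\in A$, $$\Delta_L(a\,db)=\Delta(a)(id\otimes d)\Delta(b),\qquad \Delta_R(a\,db)=\Delta(a)(d\otimes id)\Delta(b).$$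
   Context: Repeated indices are summed; $\Delta(a)=a_1\otimes a_2$ and $\Delta'(\psi)=\psi_1\otimes\psi_2$ denote the coproducts of $A$ and $U$, $\varepsilon'$ and $\kappa'$ the counit and antipode of $U$. A Hopf pairing satisfies $\langle\psi\phi,a\rangle=\langle\psi\otimes\phi,\Delta a\rangle$, $\langle I,a\rangle=\varepsilon(a)$, $\langle\Delta'(\psi),a\otimes b\rangle=\langle\psi,ab\rangle$, $\varepsilon'(\psi)=\langle\psi,I\rangle$, $\langle\kappa'(\psi),a\rangle=\langle\psi,\kappa(a)\rangle$; nondegenerate means that each algebra separates the points of the other. The adjoint action is $\mathrm{ad}_\psi\varphi=\kappa'(\psi_1)\varphi\psi_2$. For $\chi\in U$, $\chi*a=a_1\langle\chi,a_2\rangle$. The elements $M_i{}^j$ exist: if $y^j\in A$ satisfy $\langle\chi_i,y^j\rangle=\delta_i^j$, then $M_i{}^j=\langle\chi_i,y^j_2\rangle\,\kappa(y^j_1)\,y^j_3$ (where $y_1\otimes y_2\otimes y_3=(\Delta\otimes id)\Delta(y)$). *)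

(* Defs.v *)
From HB Require Import structures.
From mathcomp Require Import all_boot all_order all_algebra.
From mathcomp Require Import boolp reals.
From mathcomp.real_closed Require Import complex.

Set Implicit Arguments.
Unset Strict Implicit.
Unset Printing Implicit Defensive.

Import GRing.Theory.
Local Open Scope ring_scope.
Local Open Scope quotient_scope.

(* The algebraic tensor product over K: formal sums of pairs, two of which    *)
(* are identified when every bilinear map takes the same value on both.  The  *)
(* universal property is tens_bilinear, tliftE, tlift_linear, tlift_unique.   *)

Section Tensor.
Variables (K : fieldType) (V W : lmodType K).

Definition fsum (Z : nmodType) (f : V -> W -> Z) (s : seq (V * W)) : Z :=
  \sum_(p <- s) f p.1 p.2.

Definition tens_eqv (s t : seq (V * W)) : bool :=
  `[< forall (Z : lmodType K) (f : V -> W -> Z),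
        bilinear_for *:%R *:%R f -> fsum f s = fsum f t >].

Fact tens_eqv_refl : reflexive tens_eqv.
Proof. by move=> s; apply/asboolP. Qed.

Fact tens_eqv_sym : symmetric tens_eqv.
Proof.
by move=> s t; apply/asboolP/asboolP => h Z f hf; rewrite (h Z f hf).
Qed.

Fact tens_eqv_trans : transitive tens_eqv.
Proof.
move=> t s u /asboolP h1 /asboolP h2; apply/asboolP => Z f hf.
by rewrite (h1 Z f hf) (h2 Z f hf).
Qed.

Canonical tens_equiv := EquivRel tens_eqv tens_eqv_refl tens_eqv_sym tens_eqv_trans.

Definition tensor := {eq_quot tens_equiv}.
HB.instance Definition _ := Choice.on tensor.

Definition tens_cls (s : seq (V * W)) : tensor := \pi_tensor s.
Definition tens (v : V) (w : W) : tensor := tens_cls [:: (v, w)].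

(* Sweedler notation: if t = t_1 (x) t_2 (summation understood) and f is      *)
(* bilinear, then tlift f t is f t_1 t_2.  Not meaningful otherwise.          *)
Definition tlift (Z : nmodType) (f : V -> W -> Z) (t : tensor) : Z :=
  fsum f (repr t).

Lemma tens_clsP s t :
  (forall (Z : lmodType K) (f : V -> W -> Z),
     bilinear_for *:%R *:%R f -> fsum f s = fsum f t) -> tens_cls s = tens_cls t.
Proof. by move=> h; apply/eqquotP/asboolP. Qed.

Lemma tlift_cls (Z : lmodType K) (f : V -> W -> Z) s :
  bilinear_for *:%R *:%R f -> tlift f (tens_cls s) = fsum f s.
Proof.
move=> hf; have /eqquotP/asboolP h : repr (tens_cls s) = s %[mod tensor].
  by rewrite reprK.
exact: h.
Qed.

Lemma tens_repr (t : tensor) : tens_cls (repr t) = t.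
Proof. by rewrite /tens_cls reprK. Qed.

Lemma tensP (t u : tensor) :
  (forall (Z : lmodType K) (f : V -> W -> Z),
     bilinear_for *:%R *:%R f -> tlift f t = tlift f u) -> t = u.
Proof. by move=> h; rewrite -[t]tens_repr -[u]tens_repr; apply: tens_clsP. Qed.

Definition tens_zero : tensor := tens_cls [::].
Definition tens_add (t u : tensor) : tensor := tens_cls (repr t ++ repr u).
Definition tens_scale (c : K) (t : tensor) : tensor :=
  tens_cls [seq (c *: p.1, p.2) | p <- repr t].
Definition tens_opp (t : tensor) : tensor := tens_scale (-1) t.

Section LiftOps.
Variables (Z : lmodType K) (f : V -> W -> Z).
Hypothesis hf : bilinear_for *:%R *:%R f.

Fact tlift_zero : tlift f tens_zero = 0.
Proof. by rewrite tlift_cls // /fsum big_nil. Qed.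

Fact tlift_add t u : tlift f (tens_add t u) = tlift f t + tlift f u.
Proof. by rewrite tlift_cls // /fsum big_cat. Qed.

Fact tlift_scale c t : tlift f (tens_scale c t) = c *: tlift f t.
Proof.
rewrite tlift_cls // /tlift /fsum big_map scaler_sumr; apply: eq_bigr => p _ /=.
exact: (scalable_linear (hf.1 p.2)).
Qed.

Fact tlift_opp t : tlift f (tens_opp t) = - tlift f t.
Proof. by rewrite tlift_scale scaleN1r. Qed.
End LiftOps.

Local Ltac tens_tac :=
  apply: tensP => Z f hf; rewrite ?(tlift_opp, tlift_scale, tlift_add, tlift_zero) //.

Fact tens_addA : associative tens_add.
Proof. by move=> x y z; do !tens_tac; rewrite addrA. Qed.
Fact tens_addC : commutative tens_add.
Proof. by move=> x y; tens_tac; rewrite addrC. Qed.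
Fact tens_add0 : left_id tens_zero tens_add.
Proof. by move=> x; tens_tac; rewrite add0r. Qed.
Fact tens_addN : left_inverse tens_zero tens_opp tens_add.
Proof. by move=> x; tens_tac; rewrite addNr. Qed.

HB.instance Definition _ :=
  GRing.isZmodule.Build tensor tens_addA tens_addC tens_add0 tens_addN.

Fact tens_scaleA a b t : tens_scale a (tens_scale b t) = tens_scale (a * b) t.
Proof. by tens_tac; rewrite scalerA. Qed.
Fact tens_scale1 : left_id 1 tens_scale.
Proof. by move=> t; tens_tac; rewrite scale1r. Qed.
Fact tens_scaleDr : right_distributive tens_scale +%R.
Proof. by move=> c t u; tens_tac; rewrite scalerDr. Qed.
Fact tens_scaleDl t : {morph tens_scale^~ t : a b / a + b}.
Proof. by move=> a b; tens_tac; rewrite scalerDl. Qed.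

HB.instance Definition _ := GRing.Zmodule_isLmodule.Build K tensor
  tens_scaleA tens_scale1 tens_scaleDr tens_scaleDl.

Lemma tlift_linear (Z : lmodType K) (f : V -> W -> Z) :
  bilinear_for *:%R *:%R f -> linear (tlift f).
Proof. by move=> hf c t u; rewrite [LHS]tlift_add // tlift_scale. Qed.

Lemma tliftE (Z : lmodType K) (f : V -> W -> Z) v w :
  bilinear_for *:%R *:%R f -> tlift f (tens v w) = f v w.
Proof. by move=> hf; rewrite tlift_cls // /fsum big_seq1. Qed.

Lemma tens_bilinear : bilinear_for *:%R *:%R tens.
Proof.
split=> [w c v v'|v c w w']; apply: tensP => Z f hf;
  rewrite tlift_linear // !tliftE //; [exact: hf.1 | exact: hf.2].
Qed.

Lemma tens_sum (t : tensor) : t = \sum_(p <- repr t) tens p.1 p.2.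
Proof.
suff h s : tens_cls s = \sum_(p <- s) tens p.1 p.2 by rewrite -h tens_repr.
elim: s => [|[v w] s IHs]; first by rewrite big_nil.
rewrite big_cons -IHs; apply: tensP => Z f hf.
by rewrite [RHS]tlift_add // tliftE // !tlift_cls // /fsum big_cons.
Qed.

Lemma tens_ind (P : tensor -> Prop) :
    (forall v w, P (tens v w)) -> P 0 -> (forall t u, P t -> P u -> P (t + u)) ->
  forall t, P t.
Proof.
by move=> hv h0 hD t; rewrite [t]tens_sum; apply: big_ind => // p _; apply: hv.
Qed.

Lemma tlift_unique (Z : lmodType K) (f : V -> W -> Z) (g : {linear tensor -> Z}) :
  (forall v w, g (tens v w) = f v w) -> forall t, g t = tlift f t.
Proof.
by move=> h t; rewrite {1}[t]tens_sum linear_sum; apply: eq_bigr => p _; apply: h.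
Qed.

Lemma tens_lin_ext (Z : lmodType K) (g h : tensor -> Z) :
    linear g -> linear h -> (forall v w, g (tens v w) = h (tens v w)) ->
  forall t, g t = h t.
Proof.
move=> hg hh e; apply: tens_ind => // [|t u IHt IHu].
  have z (k : tensor -> Z) : linear k -> k 0 = 0.
    by move=> /zmod_morphism_linear hk; rewrite -(subr0 0) hk subrr.
  by rewrite !z.
by rewrite -(scale1r t) hg hh IHt IHu.
Qed.

End Tensor.

Notation "V ⊗ W" := (tensor V%type W%type) (at level 40, left associativity) : type_scope.
Notation "v ⊗ w" := (tens v w) (at level 40, left associativity) : ring_scope.

Section TensorMaps.
Variable K : fieldType.
Implicit Types V W X Y : lmodType K.

Definition tmap V W V' W' (f : V -> V') (g : W -> W') : V ⊗ W -> V' ⊗ W' :=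
  tlift (fun v w => f v ⊗ g w).

Definition tassoc V W X : (V ⊗ W) ⊗ X -> V ⊗ (W ⊗ X) :=
  tlift (fun t x => tlift (fun v w => v ⊗ (w ⊗ x)) t).

(* The componentwise action, (v ⊗ w).(x ⊗ y) = f v x ⊗ g w y *)
Definition tact V W X Y X' Y' (f : V -> X -> X') (g : W -> Y -> Y')
    (t : V ⊗ W) (u : X ⊗ Y) : X' ⊗ Y' :=
  tlift (fun v w => tmap (f v) (g w) u) t.

Lemma tmap_bilinear V W V' W' (f : V -> V') (g : W -> W') :
  linear f -> linear g -> bilinear_for *:%R *:%R (fun v w => f v ⊗ g w).
Proof.
move=> hf hg; split=> [w c v v'|v c w w'] /=.
  by rewrite hf; apply: (tens_bilinear _ _).1.
by rewrite hg; apply: (tens_bilinear _ _).2.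
Qed.

Lemma tmap_linear V W V' W' (f : V -> V') (g : W -> W') :
  linear f -> linear g -> linear (tmap f g).
Proof. by move=> hf hg; apply/tlift_linear/tmap_bilinear. Qed.

Lemma tmapE V W V' W' (f : V -> V') (g : W -> W') v w :
  linear f -> linear g -> tmap f g (v ⊗ w) = f v ⊗ g w.
Proof. by move=> hf hg; rewrite /tmap tliftE //; apply: tmap_bilinear. Qed.

Section Act.
Variables (V W X Y X' Y' : lmodType K).
Variables (f : V -> X -> X') (g : W -> Y -> Y').
Hypotheses (hf : bilinear_for *:%R *:%R f) (hg : bilinear_for *:%R *:%R g).

Let tact_bil u : bilinear_for *:%R *:%R (fun v w => tmap (f v) (g w) u).
Proof.
split=> [w c v v'|v c w w'] /=; elim/tens_ind: u => [x y||t u IHt IHu].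
- rewrite !tmapE; try exact: hf.2; try exact: hg.2.
  by rewrite hf.1; apply: (tens_bilinear _ _).1.
- have z v0 : tmap (f v0) (g w) 0 = 0.
    have /zmod_morphism_linear h : linear (tmap (f v0) (g w)).
      by apply: tmap_linear; [exact: hf.2 | exact: hg.2].
    by rewrite -(subr0 0) h subrr.
  by rewrite !z scaler0 addr0.
- have D v0 : tmap (f v0) (g w) (t + u) = tmap (f v0) (g w) t + tmap (f v0) (g w) u.
    have h : linear (tmap (f v0) (g w)).
      by apply: tmap_linear; [exact: hf.2 | exact: hg.2].
    by rewrite -[t]scale1r h !scale1r.
  by rewrite !D IHt IHu scalerDr addrACA.
- rewrite !tmapE; try exact: hf.2; try exact: hg.2.
  by rewrite hg.1; apply: (tens_bilinear _ _).2.
- have z w0 : tmap (f v) (g w0) 0 = 0.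
    have /zmod_morphism_linear h : linear (tmap (f v) (g w0)).
      by apply: tmap_linear; [exact: hf.2 | exact: hg.2].
    by rewrite -(subr0 0) h subrr.
  by rewrite !z scaler0 addr0.
- have D w0 : tmap (f v) (g w0) (t + u) = tmap (f v) (g w0) t + tmap (f v) (g w0) u.
    have h : linear (tmap (f v) (g w0)).
      by apply: tmap_linear; [exact: hf.2 | exact: hg.2].
    by rewrite -[t]scale1r h !scale1r.
  by rewrite !D IHt IHu scalerDr addrACA.
Qed.

Lemma tactE v w x y : tact f g (v ⊗ w) (x ⊗ y) = f v x ⊗ g w y.
Proof. by rewrite /tact tliftE ?tmapE //; [exact: hf.2 | exact: hg.2]. Qed.

Lemma tact_linear_l u : linear ((tact f g)^~ u).
Proof. exact: tlift_linear. Qed.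

Lemma tact_linear_r t : linear (tact f g t).
Proof.
move=> c u u'; elim/tens_ind: t => [v w||t t' IHt IHt'].
- rewrite /tact !tliftE //; apply: tmap_linear; [exact: hf.2 | exact: hg.2].
- have z u0 : tact f g 0 u0 = 0.
    have /zmod_morphism_linear h := tact_linear_l u0.
    by rewrite -(subr0 0) h subrr.
  by rewrite !z scaler0 addr0.
- have D u0 : tact f g (t + t') u0 = tact f g t u0 + tact f g t' u0.
    by have := tact_linear_l u0 1 t t'; rewrite !scale1r.
  by rewrite !D IHt IHt' scalerDr addrACA.
Qed.

End Act.
End TensorMaps.

Section TensorRing.
Variables (K : fieldType) (A B : algType K).
Local Notation mul := (tact (@GRing.mul A) (@GRing.mul B)).

Fact mulr_bilinear (C : algType K) : bilinear_for *:%R *:%R (@GRing.mul C).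
Proof.
by split=> [y c x x'|x c y y'] /=; rewrite ?mulrDl ?mulrDr -?scalerAl -?scalerAr.
Qed.

Let mulE a b a' b' : mul (a ⊗ b) (a' ⊗ b') = (a * a') ⊗ (b * b').
Proof. by rewrite tactE //; apply: mulr_bilinear. Qed.

Let mulDl : left_distributive mul +%R.
Proof.
move=> t t' u.
have := tact_linear_l (mulr_bilinear A) (mulr_bilinear B) u 1 t t'.
by rewrite !scale1r.
Qed.

Let mulDr : right_distributive mul +%R.
Proof.
move=> t u u'.
have := tact_linear_r (mulr_bilinear A) (mulr_bilinear B) t 1 u u'.
by rewrite !scale1r.
Qed.

Let mul0l t : mul 0 t = 0.
Proof. by apply: (addIr (mul 0 t)); rewrite -mulDl !add0r. Qed.
Let mul0r t : mul t 0 = 0.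
Proof. by apply: (addIr (mul t 0)); rewrite -mulDr !add0r. Qed.

Fact tens_mulA : associative mul.
Proof.
move=> x y z; elim/tens_ind: x => [a b||t u IHt IHu].
- elim/tens_ind: y => [a' b'||t u IHt IHu].
  + elim/tens_ind: z => [a2 b2||t u IHt IHu].
    * by rewrite !mulE !mulrA.
    * by rewrite !mul0r.
    * by rewrite !mulDr IHt IHu.
  + by rewrite !(mul0l, mul0r).
  + by rewrite !(mulDl, mulDr) IHt IHu.
- by rewrite !mul0l.
- by rewrite !mulDl IHt IHu.
Qed.

Fact tens_mul1l : left_id (1 ⊗ 1) mul.
Proof.
elim/tens_ind => [a b||t u IHt IHu]; first by rewrite mulE !mul1r.
  by rewrite mul0r.
by rewrite mulDr IHt IHu.
Qed.

Fact tens_mul1r : right_id (1 ⊗ 1) mul.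
Proof.
elim/tens_ind => [a b||t u IHt IHu]; first by rewrite mulE !mulr1.
  by rewrite mul0l.
by rewrite mulDl IHt IHu.
Qed.

HB.instance Definition _ := GRing.Zmodule_isPzRing.Build (tensor A B)
  tens_mulA tens_mul1l tens_mul1r mulDl mulDr.

Lemma mul_tens (a a' : A) (b b' : B) :
  (a ⊗ b) * (a' ⊗ b') = (a * a') ⊗ (b * b').
Proof. exact: mulE. Qed.

End TensorRing.


Record hopf_axioms (K : fieldType) (A : algType K) (Delta : A -> A ⊗ A)
    (eps : A -> K) (kappa : A -> A) : Prop := HopfAxioms {
  comul_linear : linear Delta;
  comul_monoid : monoid_morphism Delta;
  counit_scalar : scalar eps;
  counit_monoid : monoid_morphism eps;
  antipode_linear : linear kappa;
  comulA : forall a,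
    tassoc (tmap Delta idfun (Delta a)) = tmap idfun Delta (Delta a);
  counitl : forall a, tlift (fun x y => eps x *: y) (Delta a) = a;
  counitr : forall a, tlift (fun x y => eps y *: x) (Delta a) = a;
  antipodel : forall a,
    tlift (fun x y => kappa x * y) (Delta a) = (eps a)%:A;
  antipoder : forall a,
    tlift (fun x y => x * kappa y) (Delta a) = (eps a)%:A
}.

HB.mixin Record Algebra_isHopf (K : fieldType) A of GRing.Algebra K A := {
  comul : A -> A ⊗ A;
  counit : A -> K;
  antipode : A -> A;
  hopfP : hopf_axioms comul counit antipode
}.

#[short(type="hopfAlgType")]
HB.structure Definition HopfAlgebra (K : fieldType) :=
  {A of Algebra_isHopf K A & GRing.Algebra K A}.

Section Pairing.
Variables (K : fieldType) (U A : hopfAlgType K) (pair : U -> A -> K).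

Definition pair2 (x : U ⊗ U) (t : A ⊗ A) : K :=
  tlift (fun psi phi => tlift (fun a b => pair psi a * pair phi b) t) x.

Record hopf_pairing : Prop := HopfPairing {
  pair_bilinear : bilinear_for *%R *%R pair;
  pairMl : forall (psi phi : U) (a : A),
    pair (psi * phi) a = pair2 (psi ⊗ phi) (comul a);
  pair1l : forall a : A, pair 1 a = counit a;
  pairMr : forall (psi : U) (a b : A),
    pair2 (comul psi) (a ⊗ b) = pair psi (a * b);
  pair1r : forall psi : U, counit psi = pair psi 1;
  pair_antipode : forall (psi : U) (a : A),
    pair (antipode psi) a = pair psi (antipode a)
}.

Definition nondegenerate_pairing : Prop :=
  (forall psi phi : U, (forall a, pair psi a = pair phi a) -> psi = phi) /\
  (forall a b : A, (forall psi, pair psi a = pair psi b) -> a = b).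

Definition ad (psi phi : U) : U :=
  tlift (fun x y => antipode x * phi * y) (comul psi).

Definition conv (chi : U) (a : A) : A :=
  tlift (fun x y => pair chi y *: x) (comul a).

End Pairing.

Definition is_basis (K : fieldType) (V : lmodType K) (T : {pred V}) (n : nat)
    (e : 'I_n -> V) : Prop :=
  [/\ forall i, e i \in T,
      forall c : 'I_n -> K, \sum_i c i *: e i = 0 -> forall i, c i = 0
    & forall v, v \in T -> exists c : 'I_n -> K, v = \sum_i c i *: e i].

(* The free left A-module with basis omega^i, i < n, as a K-vector space; its *)
(* left A-module structure is lact.                                           *)
Section FreeLeftModule.
Variables (K : fieldType) (A : algType K) (n : nat).

Definition free_lmod : Type := {ffun 'I_n -> A}.
HB.instance Definition _ := GRing.Lmodule.on free_lmod.

Definition lact (a : A) (g : free_lmod) : free_lmod :=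
  a *: (g : {ffun 'I_n -> A^o}).

Definition omega (i : 'I_n) : free_lmod := [ffun j => (i == j)%:R].

Lemma free_lmodE (g : free_lmod) : g = \sum_i lact (g i) (omega i).
Proof.
apply/ffunP => j; rewrite sum_ffunE (bigD1 j) //= big1 => [|i /negPf ij].
  by rewrite !ffunE eqxx addr0 [_ *: _]mulr1.
by rewrite !ffunE ij [_ *: _]mulr0.
Qed.

Lemma scale_lact c (g : free_lmod) : c *: g = lact c%:A g.
Proof. by apply/ffunP => j; rewrite !ffunE [RHS]mulr_algl. Qed.

End FreeLeftModule.

Section Calculus.
Variables (K : fieldType) (U A : hopfAlgType K) (pair : U -> A -> K).
Variables (n : nat) (chi : 'I_n -> U) (M : 'I_n -> 'I_n -> A).
Local Notation Gamma := (free_lmod A n).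

Definition ext_diff (a : A) : Gamma :=
  \sum_i lact (conv pair (chi i) a) (omega A i).

(* left actions of A ⊗ A on A ⊗ Gamma and on Gamma ⊗ A *)
Definition actL : A ⊗ A -> A ⊗ Gamma -> A ⊗ Gamma := tact *%R (@lact K A n).
Definition actR : A ⊗ A -> Gamma ⊗ A -> Gamma ⊗ A := tact (@lact K A n) *%R.

Definition coactL (g : Gamma) : A ⊗ Gamma :=
  \sum_i actL (comul (g i)) (1 ⊗ omega A i).

(* M j i is the element M_j^i: lower index first. *)
Definition coactR (g : Gamma) : Gamma ⊗ A :=
  \sum_i actR (comul (g i)) (\sum_j omega A j ⊗ M j i).

End Calculus.

(* Main.v *)
Require Import Defs.
From mathcomp Require Import all_boot all_order all_algebra.
From mathcomp Require Import reals.
From mathcomp.real_closed Require Import complex.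
Set Implicit Arguments.
Unset Strict Implicit.
Unset Printing Implicit Defensive.
Import GRing.Theory.
Local Open Scope ring_scope.

(** Write chi * b = b_1 <chi, b_2> and b * chi = <chi, b_1> b_2, so that
    db = (chi_i * b) omega^i.  Both coactions are compatible with the action
    of A, because Delta is multiplicative ([coactL_lact], [coactR_lact]);
    hence it is enough to treat a = 1.

    On the left, coassociativity gives Delta(chi * b) = b_1 (x) (chi * b_2)
    ([comul_conv]), which is the claim.

    On the right, the same formula turns Delta_R(db) into the sum over i and j
    of b_1 omega^j (x) (chi_i * b_2) M_j^i, so that everything rests on

      sum_i (chi_i * b) M_j^i = b * chi_j      ([conv_adjoint]),

    after which coassociativity moves <chi_j, b_2> to the left factor.  Since
    U separates the points of A, this identity may be checked after pairing
    with psi in U.  The left side becomes <psi_1 ad_{psi_2} chi_j, b>, the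
    right side <chi_j psi, b>, and these agree by
    psi_1 ad_{psi_2} phi = psi_1 kappa'(psi_2) phi psi_3 = phi psi
    ([tlift_mul_ad]). *)

(** * Sweedler sums *)

Section Sweedler.
Variable K : fieldType.
Implicit Types V W X Y Z : lmodType K.

(** [linear] is a predicate on bare functions here: the maps below depend on
    hypotheses or parameters and carry no bundled structure. *)
Lemma linear_addE V Z (h : V -> Z) x y : linear h -> h (x + y) = h x + h y.
Proof. by move=> hh; have := hh 1 x y; rewrite !scale1r. Qed.

Lemma linear_zeroE V Z (h : V -> Z) : linear h -> h 0 = 0.
Proof. by move=> /zmod_morphism_linear hh; rewrite -(subr0 0) hh subrr. Qed.

Lemma linear_scaleE V Z (h : V -> Z) c x : linear h -> h (c *: x) = c *: h x.
Proof. by move=> hh; have := hh c x 0; rewrite (linear_zeroE hh) !addr0. Qed.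

Lemma linear_sumE V Z (h : V -> Z) I (r : seq I) (F : I -> V) :
  linear h -> h (\sum_(i <- r) F i) = \sum_(i <- r) h (F i).
Proof.
move=> hh; apply: (big_morph h) => [x y|]; first exact: linear_addE.
exact: linear_zeroE.
Qed.

Lemma sum_linear V Z I (r : seq I) (h : I -> V -> Z) :
  (forall i, linear (h i)) -> linear (fun x => \sum_(i <- r) h i x).
Proof.
move=> hh c x y; rewrite scaler_sumr -big_split.
by apply: eq_bigr => i _; apply: hh.
Qed.

Lemma eq_tlift V W (Z : nmodType) (f g : V -> W -> Z) t :
  (forall v w, f v w = g v w) -> tlift f t = tlift g t.
Proof. by move=> fg; apply: eq_bigr. Qed.

Lemma linear_tlift V W X Y (h : X -> Y) (f : V -> W -> X) t :
  linear h -> h (tlift f t) = tlift (fun v w => h (f v w)) t.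
Proof. exact: linear_sumE. Qed.

Lemma sum_tlift V W (Z : nmodType) I (r : seq I) (f : I -> V -> W -> Z) t :
  \sum_(i <- r) tlift (f i) t = tlift (fun v w => \sum_(i <- r) f i v w) t.
Proof. exact: exchange_big. Qed.

Lemma tlift_tmap V W X Y Z (f : X -> Y -> Z) (g : V -> X) (h : W -> Y) t :
    bilinear_for *:%R *:%R f -> linear g -> linear h ->
  tlift f (tmap g h t) = tlift (fun v w => f (g v) (h w)) t.
Proof.
move=> hf hg hh; rewrite (linear_tlift _ _ (tlift_linear hf)).
by apply: eq_tlift => v w; rewrite tliftE.
Qed.

(** Linearity in each of three arguments. *)
Definition trilinear V W X Z (f : V -> W -> X -> Z) : Prop :=
  [/\ forall w x, linear (fun v => f v w x),
      forall v x, linear (fun w => f v w x)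
    & forall v w, linear (f v w)].

(** In Sweedler form the associator only moves brackets. *)
Lemma tlift_tassoc V W X Z (f : V -> W -> X -> Z) t : trilinear f ->
  tlift (fun v s => tlift (f v) s) (tassoc t)
    = tlift (fun s x => tlift (fun v w => f v w x) s) t.
Proof.
move=> [f1 f2 f3].
have hin v : bilinear_for *:%R *:%R (f v) by split=> [x|w]; [apply: f2|apply: f3].
have hout : bilinear_for *:%R *:%R (fun v s => tlift (f v) s).
  split=> [s|v]; last exact/tlift_linear/hin.
  by apply: sum_linear => p; apply: f1.
have hF x : bilinear_for *:%R *:%R (fun (v : V) (w : W) => v ⊗ (w ⊗ x)).
  split=> [w c v v'|v c w w'] /=; first exact: (tens_bilinear _ _).1.
  by rewrite (tens_bilinear _ _).1 (tens_bilinear _ _).2.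
rewrite (linear_tlift _ _ (tlift_linear hout)); apply: eq_tlift => s x.
rewrite (linear_tlift _ _ (tlift_linear hout)); apply: eq_tlift => v w.
by rewrite !tliftE.
Qed.

End Sweedler.

Section HopfSweedler.
Variables (K : fieldType) (H : hopfAlgType K).
Implicit Types (a b x y : H).

Let hopfH := hopfP (s := H).

(** Coassociativity in Sweedler form: a trilinear expression in
    a_1, (a_2)_1, (a_2)_2 equals the same expression in
    (a_1)_1, (a_1)_2, a_2. *)
Lemma tlift_comulA (Z : lmodType K) (f : H -> H -> H -> Z) a : trilinear f ->
  tlift (fun x y => tlift (f x) (comul y)) (comul a)
    = tlift (fun x y => tlift (fun u v => f u v y) (comul x)) (comul a).
Proof.
move=> hf; have [f1 f2 f3] := hf; have hD := comul_linear hopfH.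
have hid : linear (@idfun H) by [].
have hin v : bilinear_for *:%R *:%R (f v) by split=> [x|w]; [apply: f2|apply: f3].
have hl : bilinear_for *:%R *:%R (fun v s => tlift (f v) s).
  split=> [s|v]; last exact/tlift_linear/hin.
  by apply: sum_linear => p; apply: f1.
have hr : bilinear_for *:%R *:%R (fun s x => tlift (fun v w => f v w x) s).
  split=> [x|s]; last by apply: sum_linear => p; apply: f3.
  by apply: tlift_linear; split=> [w|v]; [apply: f1|apply: f2].
rewrite -[LHS](tlift_tmap _ hl hid hD) -(comulA hopfH) tlift_tassoc //.
by rewrite tlift_tmap.
Qed.

Lemma mulr_linear a : linear (fun x : H => x * a).
Proof. exact: (mulr_bilinear H).1. Qed.

Lemma mull_linear a : linear (fun x : H => a * x).
Proof. exact: (mulr_bilinear H).2. Qed.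

(** The adjoint action undoes a left multiplication:
    psi_1 ad_{psi_2} phi = psi_1 kappa'(psi_2) phi psi_3 = phi psi. *)
Lemma tlift_mul_ad (phi psi : H) :
  tlift (fun x y => x * ad y phi) (comul psi) = phi * psi.
Proof.
have hS := antipode_linear hopfH.
have hf : trilinear (fun x u v : H => x * (antipode u * phi * v)).
  split=> [u v|x v|x u] c y z; first exact: mulr_linear.
    by rewrite hS !mulrDl mulrDr -!scalerAl -scalerAr.
  by rewrite !mulrDr -!scalerAr.
transitivity (tlift (fun x y =>
    tlift (fun u v => x * (antipode u * phi * v)) (comul y)) (comul psi)).
  by apply: eq_tlift => x y; rewrite /ad (linear_tlift _ _ (mull_linear x)).
rewrite (tlift_comulA _ hf) -[in RHS](counitl hopfH psi).
rewrite (linear_tlift _ _ (mull_linear phi)); apply: eq_tlift => x y.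
rewrite -scalerAr -(mulr_algl (counit x)) -(antipoder hopfH).
rewrite (linear_tlift _ _ (mulr_linear _)); apply: eq_tlift => u v.
by rewrite !mulrA.
Qed.

End HopfSweedler.

(** * Convolution with a functional *)

Section Convolution.
Variables (K : fieldType) (U A : hopfAlgType K) (pair : U -> A -> K).
Hypothesis pair_hopf : hopf_pairing pair.

Let hopfA := hopfP (s := A).
Let hopfU := hopfP (s := U).

Lemma pair_linear_l a : linear (fun psi : U => pair psi a : K^o).
Proof. exact: (pair_bilinear pair_hopf).1. Qed.

Lemma pair_linear_r psi : linear (fun a : A => pair psi a : K^o).
Proof. exact: (pair_bilinear pair_hopf).2. Qed.

Lemma pair_mul_l psi phi a :
  pair (psi * phi) a = tlift (fun x y => pair psi x * pair phi y) (comul a).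
Proof.
rewrite (pairMl pair_hopf) /pair2.
apply: (tliftE (Z := K^o)); split=> [w|v].
- by apply: sum_linear => p c x y /=; rewrite pair_linear_l mulrDl scalerAl.
- by apply: sum_linear => p c x y /=; rewrite pair_linear_l mulrDr scalerAr.
Qed.

Lemma pair_mul_r psi a b :
  pair psi (a * b) = tlift (fun x y => pair x a * pair y b) (comul psi).
Proof.
rewrite -(pairMr pair_hopf) /pair2.
apply: eq_tlift => x y; apply: (tliftE (Z := K^o)); split=> [w|v] c u u' /=.
- by rewrite pair_linear_r mulrDl scalerAl.
- by rewrite pair_linear_r mulrDr scalerAr.
Qed.

Lemma conv_linear chi : linear (conv pair chi).
Proof.
move=> c a b; rewrite /conv (comul_linear hopfA).
apply: tlift_linear; split=> [w d x y|v d x y] /=.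
  by rewrite scalerDr !scalerA mulrC.
by rewrite pair_linear_r scalerDl scalerA.
Qed.

Lemma pair_conv psi chi b : pair psi (conv pair chi b) = pair (psi * chi) b.
Proof.
rewrite pair_mul_l (linear_tlift _ _ (pair_linear_r psi)).
apply: eq_tlift => x y; rewrite (linear_scaleE _ _ (pair_linear_r psi)).
exact: mulrC.
Qed.

(** Left convolution commutes with left translation:
    Delta(chi * b) = b_1 (x) (chi * b_2). *)
Lemma comul_conv chi b :
  comul (conv pair chi b) = tmap idfun (conv pair chi) (comul b).
Proof.
have hf : trilinear (fun x u v : A => pair chi v *: (x ⊗ u)).
  split=> [u v|x v|x u] c y z.
  - by rewrite (tens_bilinear _ _).1 scalerDr !scalerA mulrC.
  - by rewrite (tens_bilinear _ _).2 scalerDr !scalerA mulrC.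
  - by rewrite pair_linear_r scalerDl scalerA.
rewrite /conv (linear_tlift _ _ (comul_linear hopfA)).
transitivity (tlift (fun x y =>
    tlift (fun u v => pair chi y *: (u ⊗ v)) (comul x)) (comul b)).
  apply: eq_tlift => x y; rewrite (linear_scaleE _ _ (comul_linear hopfA)).
  by rewrite {1}[comul x]tens_sum scaler_sumr.
rewrite -(tlift_comulA _ hf); apply: eq_tlift => x y.
rewrite (linear_tlift _ _ ((tens_bilinear _ _).2 x)).
by apply: eq_tlift => u v; rewrite (linear_scaleE _ _ ((tens_bilinear _ _).2 x)).
Qed.

(** The right convolution b * chi = <chi, b_1> b_2. *)
Definition convr (chi : U) (b : A) : A :=
  tlift (fun x y => pair chi x *: y) (comul b).

Lemma pair_convr psi chi b : pair psi (convr chi b) = pair (chi * psi) b.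
Proof.
rewrite pair_mul_l (linear_tlift _ _ (pair_linear_r psi)).
by apply: eq_tlift => x y; rewrite (linear_scaleE _ _ (pair_linear_r psi)).
Qed.

Section Adjoint.
Hypothesis pair_sepA :
  forall a b : A, (forall psi, pair psi a = pair psi b) -> a = b.
Variables (n : nat) (chi : 'I_n -> U) (M : 'I_n -> 'I_n -> A).
Hypothesis M_def :
  forall psi i, ad psi (chi i) = \sum_j pair psi (M i j) *: chi j.

(** The matrix of the adjoint action turns left convolutions into right ones:
    paired with psi, both sides give <psi_1 ad_{psi_2} chi_j, b>. *)
Lemma conv_adjoint j b : \sum_i conv pair (chi i) b * M j i = convr (chi j) b.
Proof.
apply: pair_sepA => psi; rewrite pair_convr -tlift_mul_ad.
rewrite (linear_tlift _ _ (pair_linear_l b)) (linear_sumE _ _ (pair_linear_r psi)).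
under eq_bigr do rewrite pair_mul_r.
rewrite sum_tlift; apply: eq_tlift => x y.
rewrite M_def mulr_sumr (linear_sumE _ _ (pair_linear_l b)).
apply: eq_bigr => i _; rewrite pair_conv -scalerAr.
by rewrite (linear_scaleE _ _ (pair_linear_l b)) mulrC.
Qed.

End Adjoint.
End Convolution.

(** * Coactions on the free module *)

Section Coactions.
Variables (K : fieldType) (A : hopfAlgType K) (n : nat).
Local Notation Gamma := (free_lmod A n).

Let hopfA := hopfP (s := A).

Lemma lact_bilinear : bilinear_for *:%R *:%R (@lact K A n).
Proof.
split=> [g c a b|a c g h]; apply/ffunP => i; rewrite !ffunE.
  by rewrite [LHS]mulrDl -scalerAl.
by rewrite [LHS]mulrDr -scalerAr.
Qed.

Lemma lactA a b (g : Gamma) : lact (a * b) g = lact a (lact b g).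
Proof. by apply/ffunP => i; rewrite !ffunE; apply/esym/mulrA. Qed.

Lemma lactE a (g : Gamma) i : lact a g i = a * g i.
Proof. by rewrite ffunE. Qed.

(** If f and g are module actions of B and C, then the componentwise map is a
    module action of B (x) C, as far as associativity is concerned. *)
Lemma tact_mul (B C : algType K) (X Y : lmodType K)
    (f : B -> X -> X) (g : C -> Y -> Y) s t u :
    bilinear_for *:%R *:%R f -> bilinear_for *:%R *:%R g ->
    (forall b b' x, f (b * b') x = f b (f b' x)) ->
    (forall c c' y, g (c * c') y = g c (g c' y)) ->
  tact f g (s * t) u = tact f g s (tact f g t u).
Proof.
move=> hf hg fA gA.
have L := tact_linear_l hf hg; have R := tact_linear_r hf hg.
elim/tens_ind: s => [b c||s s' IH IH'].
- elim/tens_ind: t => [b' c'||t t' IH IH'].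
  + elim/tens_ind: u => [x y||u u' IH IH'].
    * by rewrite mul_tens !tactE // fA gA.
    * by rewrite !(linear_zeroE (R _)).
    * by rewrite !(linear_addE _ _ (R _)) IH IH'.
  + by rewrite mulr0 (linear_zeroE (L u)) (linear_zeroE (R _)).
  + by rewrite mulrDr !(linear_addE _ _ (L u)) IH IH' (linear_addE _ _ (R _)).
- by rewrite mul0r !(linear_zeroE (L _)).
- by rewrite mulrDl !(linear_addE _ _ (L _)) IH IH'.
Qed.

Lemma coactL_lact a (g : Gamma) : coactL (lact a g) = actL (comul a) (coactL g).
Proof.
have hm := mulr_bilinear A; have hl := lact_bilinear.
rewrite /coactL /actL (linear_sumE _ _ (tact_linear_r hm hl _)).
apply: eq_bigr => i _; rewrite lactE (comul_monoid hopfA).2.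
by apply: tact_mul => // *; rewrite ?mulrA ?lactA.
Qed.

Lemma coactR_lact (M : 'I_n -> 'I_n -> A) a (g : Gamma) :
  coactR M (lact a g) = actR (comul a) (coactR M g).
Proof.
have hm := mulr_bilinear A; have hl := lact_bilinear.
rewrite /coactR /actR (linear_sumE _ _ (tact_linear_r hl hm _)).
apply: eq_bigr => i _; rewrite lactE (comul_monoid hopfA).2.
by apply: tact_mul => // *; rewrite ?mulrA ?lactA.
Qed.

End Coactions.

(** * Bicovariance of the exterior differential *)

Section Bicovariance.
Variables (K : fieldType) (U A : hopfAlgType K) (pair : U -> A -> K).
Hypothesis pair_hopf : hopf_pairing pair.
Variables (n : nat) (chi : 'I_n -> U).
Local Notation Gamma := (free_lmod A n).
Local Notation d := (ext_diff pair chi).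

Lemma ext_diffE a i : d a i = conv pair (chi i) a.
Proof.
rewrite sum_ffunE (bigD1 i) //= big1 => [|j /negPf ij].
  by rewrite lactE ffunE eqxx mulr1 addr0.
by rewrite lactE ffunE ij mulr0.
Qed.

Lemma ext_diff_linear : linear d.
Proof.
apply: sum_linear => i c a b.
by rewrite (conv_linear pair_hopf) (lact_bilinear _ _).1.
Qed.

Lemma coactL_ext_diff b : coactL (d b) = tmap idfun d (comul b).
Proof.
have hm := mulr_bilinear A; have hl := lact_bilinear A n.
rewrite /coactL /tmap.
transitivity (\sum_i tlift
    (fun x y => x ⊗ lact (conv pair (chi i) y) (omega A i)) (comul b)).
  apply: eq_bigr => i _; rewrite ext_diffE (comul_conv pair_hopf) /actL.
  rewrite (linear_tlift _ _ (tact_linear_l hm hl _)).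
  by apply: eq_tlift => x y; rewrite tactE // mulr1.
rewrite sum_tlift; apply: eq_tlift => x y.
by rewrite (linear_sumE _ _ ((tens_bilinear _ _).2 x)).
Qed.

Lemma coactR_ext_diff (M : 'I_n -> 'I_n -> A) b :
    (forall a b : A, (forall psi, pair psi a = pair psi b) -> a = b) ->
    (forall psi i, ad psi (chi i) = \sum_j pair psi (M i j) *: chi j) ->
  coactR M (d b) = tmap d idfun (comul b).
Proof.
move=> pair_sepA M_def.
have hm := mulr_bilinear A; have hl := lact_bilinear A n.
have hT := tens_bilinear Gamma A.
transitivity (\sum_j tlift
    (fun x y => lact x (omega A j) ⊗ convr pair (chi j) y) (comul b)).
  transitivity (\sum_i \sum_j tlift (fun x y =>
      lact x (omega A j) ⊗ (conv pair (chi i) y * M j i)) (comul b)).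
    apply: eq_bigr => i _; rewrite ext_diffE (comul_conv pair_hopf) /actR.
    rewrite (linear_sumE _ _ (tact_linear_r hl hm _)); apply: eq_bigr => j _.
    rewrite (linear_tlift _ _ (tact_linear_l hl hm _)).
    by apply: eq_tlift => x y; rewrite tactE.
  rewrite exchange_big; apply: eq_bigr => j _; rewrite sum_tlift.
  apply: eq_tlift => x y; rewrite -(linear_sumE _ _ (hT.2 _)).
  by rewrite (conv_adjoint pair_hopf pair_sepA M_def).
transitivity (\sum_j tlift
    (fun x y => lact (conv pair (chi j) x) (omega A j) ⊗ y) (comul b)).
  apply: eq_bigr => j _.
  have hf : trilinear (fun x u v : A =>
      pair (chi j) u *: (lact x (omega A j) ⊗ v)).
    split=> [u v|x v|x u] c y z.
    - by rewrite hl.1 hT.1 scalerDr !scalerA mulrC.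
    - by rewrite (pair_linear_r pair_hopf) scalerDl scalerA.
    - by rewrite hT.2 scalerDr !scalerA mulrC.
  (* Both sides are <chi_j, b_2> b_1 omega^j (x) b_3. *)
  transitivity (tlift (fun x y => tlift (fun u v =>
      pair (chi j) u *: (lact x (omega A j) ⊗ v)) (comul y)) (comul b)).
    apply: eq_tlift => x y; rewrite (linear_tlift _ _ (hT.2 _)).
    by apply: eq_tlift => u v; rewrite (linear_scaleE _ _ (hT.2 _)).
  rewrite (tlift_comulA _ hf); apply: eq_tlift => x y.
  rewrite (linear_tlift _ _ (hl.1 _)) (linear_tlift _ _ (hT.1 _)).
  apply: eq_tlift => u v.
  by rewrite (linear_scaleE _ _ (hl.1 _)) (linear_scaleE _ _ (hT.1 _)).
rewrite sum_tlift; apply: eq_tlift => x y.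
by rewrite -(linear_sumE _ _ (hT.1 _)).
Qed.

End Bicovariance.

Theorem proposition2p3p1 (R : realType) (U A : hopfAlgType R[i])
    (pair : U -> A -> R[i])
    (pair_hopf : hopf_pairing pair) (pair_nondeg : nondegenerate_pairing pair)
    (T : submodClosed U) (n : nat) (chi : 'I_n -> U)
    (chi_basis : is_basis T chi)
    (T_ker : forall x, x \in T -> counit x = 0)
    (T_ad : forall psi x, x \in T -> ad psi x \in T)
    (M : 'I_n -> 'I_n -> A)
    (M_def : forall psi i, ad psi (chi i) = \sum_j pair psi (M i j) *: chi j) :
  forall a b : A,
    coactL (lact a (ext_diff pair chi b))
      = actL (comul a) (tmap idfun (ext_diff pair chi) (comul b))
    /\
    coactR M (lact a (ext_diff pair chi b))
      = actR (comul a) (tmap (ext_diff pair chi) idfun (comul b)).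
Proof.
move=> a b; rewrite coactL_lact coactR_lact coactL_ext_diff //.
by rewrite (coactR_ext_diff pair_hopf _ pair_nondeg.2 M_def).
Qed.
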